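(* Let $f_n:[0,1]\rightarrow[0,1]$ ($n\in\mathbb{N}$) be a sequence of Riemann integrable functions that tends pointwise to zero, i.e. $\lim_{n\to\infty}f_n(x)=0$ for every $x\in[0,1]$. Then $\lim_{n\to\infty}\int_0^1 f_n=0$.
   Context: All integrals are Riemann integrals of real-valued functions on $[0,1]$. *)

(* Defs.v *)
(* Stdlib world: the classical reals, with Coquelicot's Riemann integral
   [RInt].  A function from [0,1] to [0,1] is a total function [R -> R] mapping
   [0,1] into itself; neither [ex_RInt g 0 1] nor [RInt g 0 1] depends on the
   values of [g] outside [0,1]. *)
From Stdlib Require Import Reals.
From Coquelicot Require Import Coquelicot.

(* Main.v *)
(* Luxemburg's argument.  Let [L n] be the supremum of the integrals of the
   continuous functions lying below [sup_{k >= n} f k].  If [L n >= d > 0] for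
   all [n], choose nearly optimal [phi n] and put
   [psi n = min (phi 0, ..., phi n)].  Since [max (phi (n+1), psi n)] has
   integral at most [L n], passing from [psi n] to [psi (n+1)] lowers the
   integral by little more than [L n - L (n+1)], so the integrals of the [psi n]
   stay above [d / 2]; but the [psi n] are continuous and decrease to 0, so
   Dini's theorem forbids this.  Finally the integral of [f n] is at most [L n],
   because a Riemann integrable function has continuous minorants with nearly
   the same integral. *)

Require Import Defs.
From Stdlib Require Import Reals Lra Lia List Classical IndefiniteDescription.
From Coquelicot Require Import Coquelicot.
Open Scope R_scope.

(** * Continuous functions on the real line: closure properties and integrals *)

Definition everywhere_continuous (g : R -> R) : Prop :=
  forall x : R, continuous g x.

Lemma everywhere_continuous_const (c : R) : everywhere_continuous (fun _ => c).
Proof. intros x; apply continuous_const. Qed.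

Lemma everywhere_continuous_plus (g h : R -> R) :
  everywhere_continuous g -> everywhere_continuous h ->
  everywhere_continuous (fun x => g x + h x).
Proof.
  intros Hg Hh x.
  exact (continuous_plus (V := R_NormedModule) g h x (Hg x) (Hh x)).
Qed.

Lemma everywhere_continuous_scal (c : R) (g : R -> R) :
  everywhere_continuous g -> everywhere_continuous (fun x => c * g x).
Proof.
  intros Hg x.
  exact (continuous_scal_r (V := R_NormedModule) c g x (Hg x)).
Qed.

(** From [max(g, h) = (g + h + |g - h|) / 2]. *)
Lemma everywhere_continuous_Rmax (g h : R -> R) :
  everywhere_continuous g -> everywhere_continuous h ->
  everywhere_continuous (fun x => Rmax (g x) (h x)).
Proof.
  intros Hg Hh x.
  apply (continuous_ext (fun y => / 2 * ((g y + h y) + Rabs (g y + -1 * h y)))).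
  - intros y; unfold Rmax, Rabs.
    destruct (Rle_dec (g y) (h y)), (Rcase_abs (g y + -1 * h y)); lra.
  - revert x; apply everywhere_continuous_scal, everywhere_continuous_plus.
    + now apply everywhere_continuous_plus.
    + intros x; apply continuous_Rabs_comp; revert x.
      now apply everywhere_continuous_plus, everywhere_continuous_scal.
Qed.

Lemma everywhere_continuous_Rmin (g h : R -> R) :
  everywhere_continuous g -> everywhere_continuous h ->
  everywhere_continuous (fun x => Rmin (g x) (h x)).
Proof.
  intros Hg Hh x.
  apply (continuous_ext (fun y => -1 * Rmax (-1 * g y) (-1 * h y))).
  - intros y; unfold Rmax, Rmin.
    destruct (Rle_dec (-1 * g y) (-1 * h y)), (Rle_dec (g y) (h y)); lra.
  - revert x; apply everywhere_continuous_scal, everywhere_continuous_Rmax;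
      now apply everywhere_continuous_scal.
Qed.

Lemma ex_RInt_everywhere_continuous (g : R -> R) (a b : R) :
  everywhere_continuous g -> ex_RInt g a b.
Proof. intros Hg; apply (ex_RInt_continuous (V := R_CompleteNormedModule)); auto. Qed.

Lemma RInt_Chasles_continuous (g : R -> R) (a b c : R) :
  everywhere_continuous g -> RInt g a c = RInt g a b + RInt g b c.
Proof.
  intros Hg; symmetry.
  apply (RInt_Chasles (V := R_CompleteNormedModule));
    now apply ex_RInt_everywhere_continuous.
Qed.

Lemma RInt_constR (a b c : R) : RInt (fun _ => c) a b = (b - a) * c.
Proof. exact (RInt_const (V := R_CompleteNormedModule) a b c). Qed.

(** * Continuous minorants of step functions and of Riemann integrable functions *)

(** A trapezoid of height [c] with steep sides, or 0 if [c * (b - a) <= 0]. Vanishing off the open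
    interval lets bumps over adjacent intervals be added. *)
Lemma continuous_bump (a b c eps : R) :
  a <= b -> 0 < eps ->
  exists phi : R -> R,
    everywhere_continuous phi /\
    (forall x, 0 <= phi x <= Rmax c 0) /\
    (forall x, x <= a \/ b <= x -> phi x = 0) /\
    c * (b - a) - eps <= RInt phi a b.
Proof.
  intros Hab Heps.
  destruct (Rle_lt_dec (c * (b - a)) 0) as [Hneg | Hpos].
  { exists (fun _ => 0); repeat split.
    - apply everywhere_continuous_const.
    - lra.
    - apply Rmax_r.
    - rewrite RInt_constR; lra. }
  assert (Hlt : a < b) by (destruct Hab; [easy | subst; lra]).
  assert (Hc : 0 < c) by nra.
  (* [eta] is the width of each sloping side: the two sides fit into [[a, b]] and cost at most
     [2 * c * eta <= eps]. *)
  set (eta := Rmin ((b - a) / 2) (eps / (2 * c))).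
  assert (Heta : 0 < eta).
  { apply Rmin_glb_lt; [lra | apply Rdiv_lt_0_compat; lra]. }
  assert (Heta1 : eta <= (b - a) / 2) by apply Rmin_l.
  assert (Heta2 : 2 * (c * eta) <= eps).
  { assert (H : eta <= eps / (2 * c)) by apply Rmin_r.
    apply (Rmult_le_compat_l (2 * c)) in H; [| lra].
    replace (2 * c * (eps / (2 * c))) with eps in H by (field; lra). lra. }
  set (k := c / eta).
  assert (Hk : 0 < k) by (apply Rdiv_lt_0_compat; lra).
  assert (Hke : k * eta = c) by (unfold k; field; lra).
  set (phi := fun x => Rmin c (Rmax 0 (k * Rmin (x + - a) (b + -1 * x)))).
  assert (Hid : everywhere_continuous (fun x => x)) by (intros x; apply continuous_id).
  assert (Hcont : everywhere_continuous phi).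
  { apply everywhere_continuous_Rmin; [apply everywhere_continuous_const |].
    apply everywhere_continuous_Rmax; [apply everywhere_continuous_const |].
    apply everywhere_continuous_scal, everywhere_continuous_Rmin;
      apply everywhere_continuous_plus;
      auto using everywhere_continuous_const, everywhere_continuous_scal. }
  assert (Hge0 : forall x, 0 <= phi x).
  { intros x; apply Rmin_glb; [lra | apply Rmax_l]. }
  exists phi; repeat split; auto.
  - rewrite Rmax_left by lra; apply Rmin_l.
  - intros x Hx; unfold phi.
    assert (Hd : Rmin (x + - a) (b + -1 * x) <= 0).
    { destruct Hx; [eapply Rle_trans; [apply Rmin_l | lra]
                   | eapply Rle_trans; [apply Rmin_r | lra]]. }
    rewrite (Rmax_left 0) by nra; apply Rmin_right; lra.
  - rewrite (RInt_Chasles_continuous phi a (a + eta) b) by easy.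
    rewrite (RInt_Chasles_continuous phi (a + eta) (b - eta) b) by easy.
    assert (H1 : 0 <= RInt phi a (a + eta)).
    { apply RInt_ge_0; auto using ex_RInt_everywhere_continuous; lra. }
    assert (H3 : 0 <= RInt phi (b - eta) b).
    { apply RInt_ge_0; auto using ex_RInt_everywhere_continuous; lra. }
    assert (H2 : RInt (fun _ => c) (a + eta) (b - eta)
                 <= RInt phi (a + eta) (b - eta)).
    { apply RInt_le; auto using ex_RInt_everywhere_continuous,
                       everywhere_continuous_const; [lra |].
      intros x Hx; unfold phi; apply Rmin_glb; [lra |].
      eapply Rle_trans; [| apply Rmax_r].
      rewrite <- Hke at 1; apply Rmult_le_compat_l; [lra |].
      apply Rmin_glb; lra. }
    rewrite RInt_constR in H2; nra.
Qed.

(** Splitting off the first interval of a subdivision is the step of both inductions below. *)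
Lemma adapted_couple_cons_inv (s : R -> R) (a b x y c : R) (l lf : list R) :
  a <= b -> adapted_couple s a b (x :: y :: l) (c :: lf) ->
  x = a /\ a <= y <= b /\ (forall t, a < t < y -> s t = c) /\
  adapted_couple s y b (y :: l) lf.
Proof.
  intros Hab H.
  assert (H' := StepFun_P7 Hab H).
  destruct H as (Hord & H0 & _ & _ & Hcst).
  simpl in H0; rewrite Rmin_left in H0 by easy; subst x.
  assert (Hay : a <= y) by (apply (Hord 0%nat); simpl; lia).
  assert (Hyb : y <= b).
  { destruct H' as (_ & H0 & _); simpl in H0; rewrite H0; apply Rmin_r. }
  split; [easy | split; [easy | split; [| easy]]].
  intros t Ht; apply (Hcst 0%nat); [simpl; lia | exact Ht].
Qed.

Lemma adapted_couple_single_inv (s : R -> R) (a b x : R) (lf : list R) :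
  a <= b -> adapted_couple s a b (x :: nil) lf -> a = b.
Proof.
  intros Hab (_ & H0 & H1 & _); simpl in H0, H1.
  rewrite Rmin_left in H0 by easy; rewrite Rmax_right in H1 by easy; congruence.
Qed.

Lemma is_RInt_adapted_couple (s : R -> R) (b : R) (l lf : list R) (a : R) :
  a <= b -> adapted_couple s a b l lf -> is_RInt s a b (Int_SF lf l).
Proof.
  revert lf a; induction l as [| x l IH]; intros lf a Hab H.
  { destruct H as (_ & _ & _ & Hlen & _); discriminate. }
  destruct l as [| y l].
  { assert (lf = nil).
    { destruct H as (_ & _ & _ & Hlen & _); destruct lf; [easy | discriminate]. }
    rewrite (adapted_couple_single_inv _ _ _ _ _ Hab H); subst lf; simpl.
    apply (is_RInt_point (V := R_NormedModule)). }
  destruct lf as [| c lf].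
  { destruct H as (_ & _ & _ & Hlen & _); discriminate. }
  destruct (adapted_couple_cons_inv _ _ _ _ _ _ _ _ Hab H)
    as (-> & Hy & Hcst & H').
  apply (is_RInt_Chasles (V := R_NormedModule) s a y b); [| now apply IH].
  apply (is_RInt_ext (V := R_NormedModule) (fun _ => c)).
  - intros t; rewrite Rmin_left, Rmax_right by easy; intros Ht.
    symmetry; auto.
  - rewrite Rmult_comm; exact (is_RInt_const (V := R_NormedModule) a y c).
Qed.

(** Add one bump per interval of the subdivision. At most one bump is nonzero at any point, and all
    vanish at the subdivision points, where the value of [s] is arbitrary. *)
Lemma continuous_below_adapted_couple
    (s : R -> R) (b : R) (l lf : list R) (a eps : R) :
  a <= b -> 0 < eps -> adapted_couple s a b l lf ->
  exists phi : R -> R,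
    everywhere_continuous phi /\
    (forall x, 0 <= phi x <= Rmax (s x) 0) /\
    (forall x, x <= a \/ b <= x -> phi x = 0) /\
    Int_SF lf l - eps <= RInt phi a b.
Proof.
  revert lf a eps; induction l as [| x l IH]; intros lf a eps Hab Heps H.
  { destruct H as (_ & _ & _ & Hlen & _); discriminate. }
  destruct l as [| y l].
  { assert (lf = nil).
    { destruct H as (_ & _ & _ & Hlen & _); destruct lf; [easy | discriminate]. }
    subst lf; exists (fun _ => 0); repeat split.
    - apply everywhere_continuous_const.
    - lra.
    - apply Rmax_r.
    - rewrite RInt_constR; simpl; lra. }
  destruct lf as [| c lf].
  { destruct H as (_ & _ & _ & Hlen & _); discriminate. }
  destruct (adapted_couple_cons_inv _ _ _ _ _ _ _ _ Hab H)
    as (-> & Hy & Hcst & H').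
  destruct (continuous_bump a y c (eps / 2)) as (p & Cp & Bp & Zp & Ip); [lra.. |].
  destruct (IH lf y (eps / 2)) as (q & Cq & Bq & Zq & Iq); [lra.. | easy |].
  assert (Cpq : everywhere_continuous (fun t => p t + q t))
    by now apply everywhere_continuous_plus.
  exists (fun t => p t + q t).
  split; [easy | split; [| split]].
  - intros t; split; [specialize (Bp t); specialize (Bq t); lra |].
    destruct (Rle_lt_dec y t) as [Hyt | Hty].
    { rewrite Zp by lra; specialize (Bq t); lra. }
    rewrite (Zq t) by lra.
    destruct (Rle_lt_dec t a) as [Hta | Hat].
    (* Since [q t = 0], the bound on [q] reads [0 <= Rmax (s t) 0], which is the goal. *)
    { rewrite Zp by lra; specialize (Bq t); rewrite (Zq t) in Bq by lra; lra. }
    rewrite Hcst by lra; specialize (Bp t); lra.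
  - intros t Ht; rewrite Zp, Zq by lra; lra.
  - rewrite (RInt_Chasles_continuous _ a y b) by easy.
    rewrite (RInt_ext (V := R_CompleteNormedModule) (fun t => p t + q t) p a y).
    2:{ intros t; rewrite Rmin_left, Rmax_right by lra; intros Ht.
        rewrite Zq by lra; apply Rplus_0_r. }
    rewrite (RInt_ext (V := R_CompleteNormedModule) (fun t => p t + q t) q y b).
    2:{ intros t; rewrite Rmin_left, Rmax_right by lra; intros Ht.
        rewrite Zp by lra; apply Rplus_0_l. }
    change (c * (y - a) + Int_SF lf (y :: l) - eps <= RInt p a y + RInt q y b).
    lra.
Qed.

Lemma is_RInt_StepFun (a b : R) (s : StepFun a b) :
  a <= b -> is_RInt s a b (RiemannInt_SF s).
Proof.
  intros Hab; unfold RiemannInt_SF; destruct (Rle_dec a b); [| easy].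
  apply is_RInt_adapted_couple; [easy | apply StepFun_P1].
Qed.

(** Integrability gives step functions with [|f - u| <= v] and the integral of [v] below [eps / 3].
    A continuous function is fitted under the positive part of [u - v], which is at most [f] because
    [f >= 0]. As [f <= u + v], passing to [u - v] costs less than [2 * eps / 3]. *)
Lemma continuous_below_ex_RInt (f : R -> R) (a b eps : R) :
  a <= b -> 0 < eps -> ex_RInt f a b ->
  (forall x, a <= x <= b -> 0 <= f x) ->
  exists phi : R -> R,
    everywhere_continuous phi /\
    (forall x, a <= x <= b -> 0 <= phi x <= f x) /\
    RInt f a b - eps <= RInt phi a b.
Proof.
  intros Hab Heps Hf Hf0.
  assert (He : 0 < eps / 3) by lra.
  destruct (ex_RInt_Reals_0 _ _ _ Hf (mkposreal _ He)) as (u & v & Huv & Hv).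
  rewrite Rmin_left, Rmax_right in Huv by easy; simpl in Hv.
  set (s := mkStepFun (StepFun_P28 (-1) u v)).
  destruct (continuous_below_adapted_couple s b (subdivision s)
              (subdivision_val s) a (eps / 3)) as (phi & C & B & _ & I);
    [easy | easy | apply StepFun_P1 |].
  assert (HI : RiemannInt_SF s - eps / 3 <= RInt phi a b).
  { unfold RiemannInt_SF; destruct (Rle_dec a b); easy. }
  assert (Hs : RiemannInt_SF s = RiemannInt_SF u + -1 * RiemannInt_SF v)
    by apply StepFun_P30.
  assert (Hle : RInt f a b <= RiemannInt_SF u + RiemannInt_SF v).
  { apply (is_RInt_le f (fun x => u x + v x) a b); [easy | | |].
    - now apply (RInt_correct (V := R_CompleteNormedModule)).
    - apply (is_RInt_plus (V := R_NormedModule)); now apply is_RInt_StepFun.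
    - intros x Hx; assert (H := Huv x ltac:(lra)).
      apply Rabs_le_between in H; lra. }
  assert (Hv' := Rle_abs (RiemannInt_SF v)).
  exists phi; repeat split; [easy | apply B | | lra].
  apply (Rle_trans _ _ _ (proj2 (B x))).
  apply Rmax_lub; [| auto].
  assert (H' := Huv x H); apply Rabs_le_between in H'.
  change (u x + -1 * v x <= f x); lra.
Qed.

(** * Continuous functions below the tail suprema *)

(* [phi <= sup_{k >= n} f k] on [[0,1]], without forming the supremum. *)
Definition below_tail_sup (f : nat -> R -> R) (n : nat) (phi : R -> R) : Prop :=
  everywhere_continuous phi /\
  forall x M : R, 0 <= x <= 1 ->
    (forall k, (n <= k)%nat -> f k x <= M) -> phi x <= M.

Lemma below_tail_sup_le (f : nat -> R -> R) (m n : nat) (phi : R -> R) :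
  (m <= n)%nat -> below_tail_sup f n phi -> below_tail_sup f m phi.
Proof.
  intros Hmn [C H]; split; [easy |].
  intros x M Hx HM; apply (H x M Hx); intros k Hk; apply HM; lia.
Qed.

Lemma below_tail_sup_Rmax (f : nat -> R -> R) (n : nat) (p q : R -> R) :
  below_tail_sup f n p -> below_tail_sup f n q ->
  below_tail_sup f n (fun x => Rmax (p x) (q x)).
Proof.
  intros [Cp Hp] [Cq Hq]; split; [now apply everywhere_continuous_Rmax |].
  intros x M Hx HM; apply Rmax_lub; eauto.
Qed.

Lemma below_tail_sup_Rmin (f : nat -> R -> R) (n : nat) (p q : R -> R) :
  below_tail_sup f n p -> everywhere_continuous q ->
  below_tail_sup f n (fun x => Rmin (p x) (q x)).
Proof.
  intros [Cp Hp] Cq; split; [now apply everywhere_continuous_Rmin |].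
  intros x M Hx HM; eapply Rle_trans; [apply Rmin_l | eauto].
Qed.

(** Turns an upper bound for the integral of the maximum into a lower bound for that of the
    minimum. *)
Lemma RInt_Rmax_Rmin (p q : R -> R) (a b : R) :
  everywhere_continuous p -> everywhere_continuous q ->
  RInt (fun x => Rmax (p x) (q x)) a b + RInt (fun x => Rmin (p x) (q x)) a b
  = RInt p a b + RInt q a b.
Proof.
  intros Cp Cq.
  transitivity (RInt (fun x => p x + q x) a b).
  - symmetry.
    rewrite (RInt_ext (V := R_CompleteNormedModule) _
               (fun x => plus (Rmax (p x) (q x)) (Rmin (p x) (q x)))).
    + apply (RInt_plus (V := R_CompleteNormedModule));
        apply ex_RInt_everywhere_continuous;
        auto using everywhere_continuous_Rmax, everywhere_continuous_Rmin.
    + intros x _; unfold plus; simpl.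
      unfold Rmax, Rmin; destruct (Rle_dec (p x) (q x)); ring.
  - apply (RInt_plus (V := R_CompleteNormedModule));
      now apply ex_RInt_everywhere_continuous.
Qed.

(** * Dini's theorem and Luxemburg's argument *)

(* Dini's argument: a cluster point of points where [psi n] exceeds [d] would be
   a point where the [psi n] do not tend to 0. *)
Lemma decreasing_continuous_RInt_small (psi : nat -> R -> R) (d : R) :
  (forall n, everywhere_continuous (psi n)) ->
  (forall n x, psi (S n) x <= psi n x) ->
  (forall x, 0 <= x <= 1 -> exists n, psi n x < d) ->
  exists n, RInt (psi n) 0 1 <= d.
Proof.
  intros C Hdec Hpt.
  apply NNPP; intros Hnot.
  assert (Hx : forall n, exists x, 0 <= x <= 1 /\ d <= psi n x).
  { intros n; apply NNPP; intros Hn; apply Hnot; exists n.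
    replace d with (RInt (fun _ => d) 0 1) by (rewrite RInt_constR; lra).
    apply RInt_le; [lra | now apply ex_RInt_everywhere_continuous | |].
    - apply ex_RInt_everywhere_continuous, everywhere_continuous_const.
    - intros x Hx; apply Rnot_lt_le; intros Hlt; apply Hn; exists x; lra. }
  apply functional_choice in Hx; destruct Hx as [u Hu].
  destruct (Bolzano_Weierstrass u (fun c => 0 <= c <= 1) (compact_P3 0 1))
    as [l Hl]; [intros n; apply Hu |].
  assert (Hmono : forall m n x, (m <= n)%nat -> psi n x <= psi m x).
  { intros m n x Hmn; induction Hmn; [lra |].
    specialize (Hdec m0 x); lra. }
  (* Otherwise the open complement of [[0, 1]] would be a neighbourhood of [l] containing some
     [u p]. *)
  assert (Hl01 : 0 <= l <= 1).
  { apply NNPP; intros Hout.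
    destruct (Hl _ 0%nat (compact_P2 _ (compact_P3 0 1) l Hout)) as [p [_ Hp]].
    apply Hp, Hu. }
  destruct (Hpt l Hl01) as [m Hm].
  assert (Hloc : locally l (fun y => psi m y < d)).
  { apply (C m l (fun z => z < d)); now apply open_lt. }
  destruct Hloc as [del Hdel].
  (* Some [u p] with [p >= m] is so close to [l] that [psi p (u p) <= psi m (u p) < d], against the
     choice of [u p]. *)
  destruct (Hl (disc l del) m) as [p [Hmp Hp]].
  { exists del; intros y Hy; exact Hy. }
  assert (H1 := Hdel (u p) Hp); simpl in H1.
  assert (H2 := Hmono m p (u p) Hmp).
  assert (H3 := Hu p); lra.
Qed.

Lemma below_tail_sup_RInt_small (f : nat -> R -> R) (d : R) :
  (forall n x, 0 <= x <= 1 -> 0 <= f n x <= 1) ->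
  (forall x, 0 <= x <= 1 -> is_lim_seq (fun n => f n x) 0) ->
  0 < d ->
  exists N, forall phi, below_tail_sup f N phi -> RInt phi 0 1 <= d.
Proof.
  intros Hf Hlim Hd.
  apply NNPP; intros Hnot.
  set (E := fun n r => exists phi, below_tail_sup f n phi /\ r = RInt phi 0 1).
  assert (HL : forall n, exists L, is_lub (E n) L).
  { intros n; destruct (completeness (E n)) as [L HL]; [| | now exists L].
    - exists 1; intros r (phi & [C H] & ->).
      replace 1 with (RInt (fun _ => 1) 0 1) at 2 by (rewrite RInt_constR; lra).
      apply RInt_le; [lra | now apply ex_RInt_everywhere_continuous | |].
      + apply ex_RInt_everywhere_continuous, everywhere_continuous_const.
      + intros x Hx; apply H; [lra |]; intros k _; apply Hf; lra.
    - exists (RInt (fun _ => 0) 0 1), (fun _ => 0); split; [| easy].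
      split; [apply everywhere_continuous_const |].
      intros x M Hx HM; apply (Rle_trans _ (f n x)); [now apply Hf | now apply HM]. }
  apply functional_choice in HL; destruct HL as [L HL].
  assert (HLub : forall n phi, below_tail_sup f n phi -> RInt phi 0 1 <= L n).
  { intros n phi H; apply (proj1 (HL n)); now exists phi. }
  assert (HLd : forall n, d < L n).
  { intros n; apply Rnot_le_lt; intros Hn; apply Hnot; exists n.
    intros phi H; specialize (HLub n phi H); lra. }
  assert (Hphi : forall n, exists phi, below_tail_sup f n phi /\
                   L n - d / 2 * (/ 2) ^ S n <= RInt phi 0 1).
  { intros n; apply NNPP; intros Hn.
    assert (Hp : 0 < (/ 2) ^ S n) by (apply pow_lt; lra).
    assert (H : L n <= L n - d / 2 * (/ 2) ^ S n); [| nra].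
    apply (proj2 (HL n)); intros r (phi & H & ->).
    apply Rnot_lt_le; intros Hlt; apply Hn; exists phi; split; [easy | lra]. }
  apply functional_choice in Hphi; destruct Hphi as [phi Hphi].
  set (psi := fix psi n := match n with
              | O => phi O
              | S m => fun x => Rmin (phi (S m) x) (psi m x)
              end).
  assert (Hpsi : forall n, below_tail_sup f n (psi n)).
  { induction n as [| n IH]; [apply Hphi |].
    apply below_tail_sup_Rmin; [apply Hphi | apply IH]. }
  assert (HI : forall n, L n - d / 2 * (1 - (/ 2) ^ S n) <= RInt (psi n) 0 1).
  { induction n as [| n IH].
    - destruct (Hphi 0%nat) as [_ H]; simpl in *; lra.
    - destruct (Hphi (S n)) as [H H'].
      assert (Hmax := HLub n _ (below_tail_sup_Rmax f n _ _
                        (below_tail_sup_le f n (S n) _ ltac:(lia) H) (Hpsi n))).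
      assert (Hsum := RInt_Rmax_Rmin (phi (S n)) (psi n) 0 1
                        (proj1 H) (proj1 (Hpsi n))).
      change (RInt (psi (S n)) 0 1)
        with (RInt (fun x => Rmin (phi (S n) x) (psi n x)) 0 1).
      change ((/ 2) ^ S (S n)) with (/ 2 * (/ 2) ^ S n) in *.
      lra. }
  destruct (decreasing_continuous_RInt_small psi (d / 2)) as [n Hn].
  - intros n; apply Hpsi.
  - intros n x; apply Rmin_r.
  - intros x Hx.
    assert (Hd4 : 0 < d / 4) by lra.
    destruct (proj2 (is_lim_seq_spec _ _) (Hlim x Hx) (mkposreal _ Hd4)) as [n Hn].
    exists n; apply (Rle_lt_trans _ (d / 4)); [| lra].
    apply (proj2 (Hpsi n)); [easy |].
    intros k Hk; specialize (Hn k Hk); simpl in Hn.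
    apply Rabs_lt_between in Hn; lra.
  - specialize (HI n); specialize (HLd n).
    assert (Hp : 0 < (/ 2) ^ S n) by (apply pow_lt; lra).
    nra.
Qed.

Theorem theorem2 (f : nat -> R -> R)
  (hf01 : forall (n : nat) (x : R), 0 <= x <= 1 -> 0 <= f n x <= 1)
  (hfint : forall n : nat, ex_RInt (f n) 0 1)
  (hflim : forall x : R, 0 <= x <= 1 ->
     is_lim_seq (fun n : nat => f n x) (Finite 0)) :
  is_lim_seq (fun n : nat => RInt (f n) 0 1) (Finite 0).
Proof.
  apply is_lim_seq_spec; intros eps.
  assert (He := cond_pos eps).
  destruct (below_tail_sup_RInt_small f (eps / 3) hf01 hflim) as [N HN]; [lra |].
  exists N; intros n Hn.
  destruct (continuous_below_ex_RInt (f n) 0 1 (eps / 3)) as (phi & C & B & I);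
    [lra | lra | easy | intros x Hx; now apply hf01 |].
  assert (Hphi : RInt phi 0 1 <= eps / 3).
  { apply HN; split; [easy |].
    intros x M Hx HM; apply (Rle_trans _ (f n x)); [now apply B | now apply HM]. }
  assert (H0 : 0 <= RInt (f n) 0 1).
  { apply RInt_ge_0; [lra | easy | intros x Hx; apply hf01; lra]. }
  apply Rabs_lt_between; lra.
Qed.
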